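(* Let $C$ be a circle packing in the plane with the combinatorics of a simply connected surface $G$ that admits a dual circle packing $C^*$. Let $MG$ be the medial graph and $z:V(MG)\to\mathbb{C}$ the tangency points of the circles. Let $\lambda:E_{int}(G)\to\mathbb{R}$ be a discrete holomorphic quadratic differential of Koebe type. Then there exists a realization of the dual mesh $\mathcal{F}:F(G)\to\mathbb{C}^3$ such that for every oriented interior edge $e_{\mathfrak{uv}}$ $$d\mathcal{F}(e_{\mathfrak{uv}}):=\mathcal{F}_{\mathrm{left}(e_{\mathfrak{uv}})}-\mathcal{F}_{\mathrm{right}(e_{\mathfrak{uv}})}=\frac{\lambda_{\mathfrak{uv}}}{\omega(e_{\mathfrak{uv}})}\begin{pmatrix}1-z_i^2\\ \mathbf{i}(1+z_i^2)\\ 2z_i\end{pmatrix},\qquad(\ast)$$ where $\mathrm{left}(e_{\mathfrak{uv}})$ and $\mathrm{right}(e_{\mathfrak{uv}})$ are the left and right faces of $e_{\mathfrak{uv}}$ and $z_i$ is the tangency point of $C_{\mathfrak u}$ and $C_{\mathfrak v}$. Furthermore: (1) $\mathrm{Re}\,\mathcal{F}$ is a discrete minimal surface of Koebe type with vertex normal $N_C$; (2) $\mathrm{Im}\,\mathcal{F}$ is a reciprocal parallel mesh of $N_{C^*}$. Corresponding edge lengths of $\mathrm{Re}\,\mathcal{F}$ and $\mathrm{Im}\,\mathcal{F}$ are the same. Conversely, given a discrete minimal surface of Koebe type $f:F(G)\to\mathbb{R}^3$ with vertex normal $N_C$ (respectively, a reciprocal parallel mesh $g:F(G)\to\mathbb{R}^3$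 of $N_{C^*}$), there exists a unique discrete holomorphic quadratic differential of Koebe type $\lambda$ for which there is an $\mathcal{F}$ satisfying $(\ast)$ with $f=\mathrm{Re}\,\mathcal{F}$ (respectively, $g=\mathrm{Im}\,\mathcal{F}$).
   Context: $G=(V,E,F)$ is a cell decomposition of an oriented simply connected surface (faces need not be triangles). A circle packing $C$ with combinatorics $G$ assigns to each $\mathfrak u\in V$ a circle $C_{\mathfrak u}\subset\mathbb{C}$, with disks of disjoint interiors, tangent for each edge $\{\mathfrak{uv}\}\in E$, in a way compatible with the orientation of $G$. It admits a dual circle packing $C^*$ if for every face $\phi\in F$ there is a circle $C^*_\phi$ passing through the tangency points of all edges of $\phi$ and intersecting the circles $C_{\mathfrak u}$, $\mathfrak u\in\phi$, orthogonally at these points; circles of adjacent faces are then tangent at the tangency point of the common edge. (If $G$ is triangulated, a dual packing always exists.) $E_{int}$, $V_{int}$: interior edges, interior vertices. The medial graph $MG$ has $V(MG)=E(G)$; $z$ assigns to each edge its tangency point. Definition of $\omega$: let $e_{\mathfrak{uv}}$ be an interior edge oriented from $\mathfrak u$ to $\mathfrak v$, with tangency point $z_i$. In the left face, let $z_k$ be the tangency point of the other edge of that face incident to $\mathfrak u$, and $z_j$ that of the other edge of that face incident to $\mathfrak v$; in the right face, let $z_m$ be the tangency point of the other edge incident to $\mathfrak u$, and $z_n$ that of the other edge incident to $\mathfrak v$. Then $$\omega(e_{\mathfrak{uv}}):=\frac{(z_k-z_i)(z_m-z_i)}{z_m-z_k}=\frac{(z_j-z_i)(z_n-z_i)}{z_n-z_j}=-\omega(e_{\mathfrak{vu}}).$$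 A discrete holomorphic quadratic differential of Koebe type is $\lambda:E_{int}(G)\to\mathbb{R}$ ($\lambda_{\mathfrak{uv}}=\lambda_{\mathfrak{vu}}$) such that for every $\mathfrak u\in V_{int}(G)$, summing over the neighbors $\mathfrak v$ of $\mathfrak u$ with $z_i$ the tangency point of $C_{\mathfrak u},C_{\mathfrak v}$: $\sum_{\mathfrak v}\frac{\lambda_{\mathfrak{uv}}}{\omega(e_{\mathfrak{uv}})}=0$, $\sum_{\mathfrak v}\frac{\lambda_{\mathfrak{uv}}}{\omega(e_{\mathfrak{uv}})}z_i=0$, $\sum_{\mathfrak v}\frac{\lambda_{\mathfrak{uv}}}{\omega(e_{\mathfrak{uv}})}z_i^2=0$. Koebe polyhedral surfaces: let $\sigma(z)=\frac{1}{1+|z|^2}(2\,\mathrm{Re}\,z,\,2\,\mathrm{Im}\,z,\,|z|^2-1)$ be stereographic projection to the unit sphere $\mathbb{S}^2\subset\mathbb{R}^3$. A Koebe polyhedral surface is a polyhedral surface with planar faces whose edges (lines) are tangent to $\mathbb{S}^2$. $N_C:F(G)\to\mathbb{R}^3$ is the Koebe polyhedral surface on the dual mesh whose face planes cut $\mathbb{S}^2$ in the circles $\sigma(C_{\mathfrak u})$; equivalently $N_{C,\phi}$ is the pole of the plane of $\sigma(C^*_\phi)$ (the apex of the cone tangent to $\mathbb{S}^2$ along $\sigma(C^*_\phi)$). $N_{C^*}:V(G)\to\mathbb{R}^3$ is the dual Koebe polyhedral surface, whose face planes cut $\mathbb{S}^2$ in the circles $\sigma(C^*_\phi)$; equivalently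 $N_{C^*,\mathfrak u}$ is the pole of the plane of $\sigma(C_{\mathfrak u})$. Standing assumption: the packings considered correspond to Koebe polyhedral surfaces, i.e. these poles are finite points (no $\sigma(C_{\mathfrak u})$ or $\sigma(C^*_\phi)$ is a great circle). For an edge $e_{\mathfrak{uv}}$, the line through $N_{C,\mathrm{left}}$ and $N_{C,\mathrm{right}}$ and the line through $N_{C^*,\mathfrak u}$ and $N_{C^*,\mathfrak v}$ both touch $\mathbb{S}^2$ at $\sigma(z_i)$. The dual mesh has vertex set $F(G)$, edges corresponding to interior edges of $G$, and faces corresponding to interior vertices of $G$. A map $f:F(G)\to\mathbb{R}^3$ is a discrete minimal surface of Koebe type with vertex normal $N_C$ if (a) $f$ is parallel to $N_C$: for every interior edge, $f_{\mathrm{left}(e_{\mathfrak{uv}})}-f_{\mathrm{right}(e_{\mathfrak{uv}})}$ is a real multiple (possibly $0$) of $N_{C,\mathrm{left}(e_{\mathfrak{uv}})}-N_{C,\mathrm{right}(e_{\mathfrak{uv}})}$; and (b) its mean curvature with respect to $N=N_C$ defined by Steiner's formula vanishes: for every face $(v_1,\dots,v_n,v_{n+1}=v_1)$ of the dual mesh, $\sum_j f_j\times N_{j+1}+N_j\times f_{j+1}=0$. A map $g:F(G)\to\mathbb{R}^3$ is a reciprocal parallel mesh of $N_{C^*}$ if for every interior edge $g_{\mathrm{left}(e_{\mathfrak{uv}})}-g_{\mathrm{right}(e_{\mathfrak{uv}})}$ is a real multiple (possibly $0$) of $N_{C^*,\mathfrak v}-N_{C^*,\mathfrak u}$. *)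

(* Defs.v *)
From HB Require Import structures.
From mathcomp Require Import all_boot all_order all_algebra.
From mathcomp Require Import all_classical all_reals.
From mathcomp Require Import complex.

Set Implicit Arguments.
Unset Strict Implicit.
Unset Printing Implicit Defensive.

Import Order.TTheory GRing.Theory Num.Theory.
Local Open Scope classical_set_scope.
Local Open Scope complex_scope.
Local Open Scope ring_scope.

(** * Cell decompositions of oriented surfaces

    A cell decomposition of an oriented surface, finite or infinite, with or
    without boundary, is encoded as a combinatorial map.  A dart is an
    oriented edge, and [flip] reverses it.  [lface d] is the face to the left of
    [d], or [None] if the surface lies only to the right of [d].  [fnext d] is
    the dart following [d] on the boundary of its left face, traversed with
    that face on the left; on darts without a left face it runs along the
    boundary of the surface, again keeping the surface on the right. *)

Record cell_decomposition := CellDecomposition {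
  dart : choiceType;
  vertex : Type;
  face : Type;
  tail : dart -> vertex;
  lface : dart -> option face;
  flip : dart -> dart;
  fnext : dart -> dart;
  fprev : dart -> dart;
  flipK : involutive flip;
  flip_neq : forall d, flip d <> d;
  fnextK : cancel fnext fprev;
  fprevK : cancel fprev fnext;
  (* [flip (fprev d)] is the dart following [d] counterclockwise around [tail d].
     As the iteration count is a natural number, these orbits are finite. *)
  tailP : forall d d',
    tail d = tail d' <-> exists n, d' = iter n (fun e => flip (fprev e)) d;
  tail_surj : forall u, exists d, tail d = u;
  lface_fnext : forall d, lface (fnext d) = lface d;
  lfaceP : forall d d' f, lface d = Some f -> lface d' = Some f ->
    exists n, d' = iter n fnext d;
  lface_surj : forall f, exists d, lface d = Some f;
  (* every edge is an edge of some face *)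
  edge_in_face : forall d, lface d = None -> lface (flip d) <> None;
  (* the faces at a boundary vertex form a single fan *)
  single_fan : forall d d', lface d = None -> lface d' = None ->
    tail d = tail d' -> d = d';
  (* edges are unordered pairs of vertices *)
  simple_edges : forall d d', tail d = tail d' ->
    tail (flip d) = tail (flip d') -> d = d' }.

Section Surface.
Variable G : cell_decomposition.
Implicit Types (d : dart G) (p q : seq (dart G)) (u v : vertex G).

Definition tip d : vertex G := tail (flip d).

(** The dart following [d] counterclockwise around [tail d]. *)
Definition vrot d : dart G := flip (fprev d).

Definition interior_dart d : Prop := lface d <> None /\ lface (flip d) <> None.

Definition interior_vertex u : Prop := forall d, tail d = u -> lface d <> None.

Definition star u : set (dart G) := [set d | tail d = u].

Fixpoint walk u v p : Prop :=
  if p is d :: p' then tail d = u /\ walk (tip d) v p' else u = v.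

(** Homotopy of edge paths from [u] to [v], rel endpoints: it is generated by
    inserting backtracks and boundaries of faces.  Boundary cycles of the
    surface may not be inserted. *)
Inductive homotopic u v : seq (dart G) -> seq (dart G) -> Prop :=
| homotopic_refl p : walk u v p -> homotopic u v p p
| homotopic_sym p q : homotopic u v p q -> homotopic u v q p
| homotopic_trans p q r :
    homotopic u v p q -> homotopic u v q r -> homotopic u v p r
| homotopic_backtrack p q d :
    walk u v (p ++ q) -> walk u v (p ++ [:: d; flip d] ++ q) ->
    homotopic u v (p ++ q) (p ++ [:: d; flip d] ++ q)
| homotopic_face p q d n :
    lface d <> None -> iter n (@fnext G) d = d ->
    walk u v (p ++ q) -> walk u v (p ++ traject (@fnext G) d n ++ q) ->
    homotopic u v (p ++ q) (p ++ traject (@fnext G) d n ++ q).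

(** The surface is connected with trivial edge-path group. *)
Definition simply_connected : Prop :=
  (forall u v, exists p, walk u v p) /\
  (forall u p, walk u u p -> homotopic u u p [::]).

(** The value of [F] at the left face of [d]; the default value [0] is never
    reached at darts that have a left face. *)
Definition at_left (T : nmodType) (F : face G -> T) d : T :=
  oapp F 0 (lface d).

Definition at_right (T : nmodType) (F : face G -> T) d : T :=
  at_left F (flip d).

End Surface.

(** * Circle packings *)

Section Circles.
Variable R : realType.

Record circle := Circle {
  center : R[i];
  radius : R;
  radius_gt0 : 0 < radius }.

Definition on_circle (A : circle) : set R[i] :=
  [set w | `|w - center A| = (radius A)%:C].

Definition open_disk (A : circle) : set R[i] :=
  [set w | `|w - center A| < (radius A)%:C].

Definition tangent_at (A B : circle) (w : R[i]) : Prop :=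
  on_circle A `&` on_circle B = [set w].

Definition orthogonal_at (A B : circle) (w : R[i]) : Prop :=
  [/\ on_circle A w, on_circle B w &
      complex.Re ((w - center A) * ((w - center B)^*)%C) = 0].

(** [a], [b], [c] form a counterclockwise triangle. *)
Definition ccw (a b c : R[i]) : Prop :=
  0 < complex.Im (((b - a)^*)%C * (c - a)).

End Circles.

(** [tp d] is the tangency point of the edge carrying [d]: the map [z] on the
    vertices of the medial graph.  Compatibility with the orientation says that
    the tangency points on each circle occur in the counterclockwise cyclic
    order of the edges around the vertex: no further tangency point of [C_u]
    lies on the counterclockwise arc from [tp d] to [tp (vrot d)]. *)
Record circle_packing (R : realType) (G : cell_decomposition) :=
  CirclePacking {
  circ : vertex G -> circle R;
  tp : dart G -> R[i];
  disks_disjoint : forall u v, u <> v ->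
    open_disk (circ u) `&` open_disk (circ v) = set0;
  circ_tangent : forall d,
    tangent_at (circ (tail d)) (circ (tip d)) (tp d);
  circ_oriented : forall d d', tail d' = tail d -> d' <> d -> d' <> vrot d ->
    ccw (tp d) (tp (vrot d)) (tp d') }.

(** [dual_tangent] says in particular that adjacent faces have different
    circles.  It excludes interior vertices of degree less than three, at which
    the denominator of [omega] below vanishes. *)
Record dual_packing (R : realType) (G : cell_decomposition)
    (C : circle_packing R G) := DualPacking {
  dcirc : face G -> circle R;
  dual_orthogonal : forall d f, lface d = Some f ->
    orthogonal_at (dcirc f) (circ C (tail d)) (tp C d) /\
    orthogonal_at (dcirc f) (circ C (tip d)) (tp C d);
  dual_tangent : forall d f f', lface d = Some f -> lface (flip d) = Some f' ->
    tangent_at (dcirc f) (dcirc f') (tp C d) }.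

Section Quadratic_differentials.
Variables (R : realType) (G : cell_decomposition) (C : circle_packing R G).

(** In the left face, [fprev d] carries the other edge incident to [tail d]; in
    the right face, [fnext (flip d)] does. *)
Definition omega (d : dart G) : R[i] :=
  let zi := tp C d in
  let zk := tp C (fprev d) in
  let zm := tp C (fnext (flip d)) in
  (zk - zi) * (zm - zi) / (zm - zk).

(** A function on the interior edges is given by its values on darts; the
    values on boundary darts are irrelevant.  The edges at [u] are in bijection
    with the neighbours of [u]. *)
Definition koebe_quadratic_differential (lam : dart G -> R) : Prop :=
  (forall d, interior_dart d -> lam (flip d) = lam d) /\
  (forall u, interior_vertex u ->
    [/\ \sum_(d \in star u) (lam d)%:C / omega d = 0,
        \sum_(d \in star u) (lam d)%:C / omega d * tp C d = 0 &
        \sum_(d \in star u) (lam d)%:C / omega d * tp C d ^+ 2 = 0]).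

End Quadratic_differentials.

(** * Geometry of three-space *)

Section Space.
Variable T : comNzRingType.

Definition vec3 (a b c : T) : 'rV[T]_3 :=
  \row_(j < 3) nth 0 [:: a; b; c] j.

Definition dot (a b : 'rV[T]_3) : T := \sum_j a 0 j * b 0 j.

Definition cross (a b : 'rV[T]_3) : 'rV[T]_3 :=
  let x : 'I_3 := inord 0 in let y : 'I_3 := inord 1 in
  let t : 'I_3 := inord 2 in
  vec3 (a 0 y * b 0 t - a 0 t * b 0 y)
       (a 0 t * b 0 x - a 0 x * b 0 t)
       (a 0 x * b 0 y - a 0 y * b 0 x).

End Space.

Section Koebe.
Variable R : realType.

Definition euclidean_norm (a : 'rV[R]_3) : R := Num.sqrt (dot a a).

(** Stereographic projection to the unit sphere. *)
Definition stereo (w : R[i]) : 'rV[R]_3 :=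
  let x := complex.Re w in let y := complex.Im w in
  let n := x ^+ 2 + y ^+ 2 in
  (1 + n)^-1 *: vec3 (2 * x) (2 * y) (n - 1).

(** [N] is the pole of the plane of [stereo A]: that plane is the polar plane
    [<N, x> = 1], equivalently each line from [N] to a point [p] of [stereo A]
    is orthogonal to [p].  Such an [N] is unique, and it exists exactly when
    [stereo A] is not a great circle. *)
Definition pole_of (N : 'rV[R]_3) (A : circle R) : Prop :=
  forall w, on_circle A w -> dot N (stereo w) = 1.

Variable G : cell_decomposition.

(** [NC] is the Koebe polyhedral surface [N_C], on the faces of [G]. *)
Definition koebe_surface (C : circle_packing R G) (D : dual_packing C)
    (NC : face G -> 'rV[R]_3) : Prop :=
  forall f, pole_of (NC f) (dcirc D f).

(** [ND] is the dual Koebe polyhedral surface [N_{C^*}], on the vertices. *)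
Definition dual_koebe_surface (C : circle_packing R G)
    (ND : vertex G -> 'rV[R]_3) : Prop :=
  forall u, pole_of (ND u) (circ C u).

Definition parallel_mesh (NC f : face G -> 'rV[R]_3) : Prop :=
  forall d l r, lface d = Some l -> lface (flip d) = Some r ->
    exists a : R, f l - f r = a *: (NC l - NC r).

(** Vanishing mean curvature in the sense of Steiner's formula.  The face of the
    dual mesh at an interior vertex [u] has its vertices in counterclockwise
    order, and its oriented edges run from the right to the left face of the
    darts at [u]. *)
Definition zero_mean_curvature (N f : face G -> 'rV[R]_3) : Prop :=
  forall u, interior_vertex u ->
    \sum_(d \in star u) (cross (at_right f d) (at_left N d) +
                         cross (at_right N d) (at_left f d)) = 0.

Definition koebe_minimal_surface (NC f : face G -> 'rV[R]_3) : Prop :=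
  parallel_mesh NC f /\ zero_mean_curvature NC f.

Definition reciprocal_parallel_mesh (ND : vertex G -> 'rV[R]_3)
    (g : face G -> 'rV[R]_3) : Prop :=
  forall d l r, lface d = Some l -> lface (flip d) = Some r ->
    exists a : R, g l - g r = a *: (ND (tip d) - ND (tail d)).

Definition same_edge_lengths (f g : face G -> 'rV[R]_3) : Prop :=
  forall d l r, lface d = Some l -> lface (flip d) = Some r ->
    euclidean_norm (f l - f r) = euclidean_norm (g l - g r).

Definition weierstrass_realization (C : circle_packing R G)
    (lam : dart G -> R) (F : face G -> 'rV[R[i]]_3) : Prop :=
  forall d l r, lface d = Some l -> lface (flip d) = Some r ->
    F l - F r = ((lam d)%:C / omega C d) *:
      vec3 (1 - tp C d ^+ 2) ('i%C * (1 + tp C d ^+ 2)) (2 * tp C d).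

Definition re_mesh (F : face G -> 'rV[R[i]]_3) (l : face G) : 'rV[R]_3 :=
  map_mx (@complex.Re R) (F l).

Definition im_mesh (F : face G -> 'rV[R[i]]_3) (l : face G) : 'rV[R]_3 :=
  map_mx (@complex.Im R) (F l).

End Koebe.

(* Main.v *)
Require Import Defs.
From mathcomp Require Import all_boot all_order all_algebra.
From mathcomp Require Import finmap all_classical all_reals.
From mathcomp Require Import complex.
From mathcomp Require Import ring lra.

(** On the dual edge of an interior dart the form [Phi(z) / omega], where
    [Phi(z) = (1 - z^2, i (1 + z^2), 2 z)], has real part tangent to the sphere
    at [stereo z] in the direction of the line through the two poles [N_C], and
    imaginary part in the direction of the line through the two poles [N_{C^*}];
    both lines pass through [stereo z].  This holds because inversion at [z]
    maps the circles through [z] to lines, which determines the argument of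
    [1 / omega].  Hence [f] is parallel to [N_C] iff its edges are
    [lam Re (Phi / omega)] for some real [lam], and [g] is reciprocal parallel to
    [N_{C^*}] iff its edges are [lam Im (Phi / omega)].

    The cross product with [stereo z] turns the real part into the imaginary part
    and the imaginary part into minus the real part.  Therefore zero mean
    curvature of [f] says that the conjugate edges [lam Im (Phi / omega)] close
    up around each interior vertex, and for [g] the edges [lam Re (Phi / omega)]
    close up automatically, since all edges around [u] may be crossed with the
    same vector [ND u].  In both cases the form [lam Phi / omega] is closed,
    which is the definition of a quadratic differential, and closed forms on
    the dual mesh are exact by simple connectedness. *)

Set Implicit Arguments.
Unset Strict Implicit.
Unset Printing Implicit Defensive.

Import Order.TTheory GRing.Theory Num.Theory.
Local Open Scope classical_set_scope.
Local Open Scope complex_scope.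
Local Open Scope ring_scope.

(** * Exactness of closed dual forms *)

Section Topology.
Variable G : cell_decomposition.
Implicit Types (d : dart G) (u v : vertex G).

Lemma tip_flip d : tip (flip d) = tail d.
Proof. by rewrite /tip flipK. Qed.

Lemma flip_interior d : interior_dart d -> interior_dart (flip d).
Proof. by case=> dl dr; split; rewrite ?flipK. Qed.

(** * Rotation around a vertex and sums over its star *)

Definition vprev d : dart G := fnext (flip d).

Lemma vrotK : cancel (@vrot G) vprev.
Proof. by move=> d; rewrite /vprev /vrot flipK fprevK. Qed.

Lemma vprevK : cancel vprev (@vrot G).
Proof. by move=> d; rewrite /vprev /vrot fnextK flipK. Qed.

Lemma tail_vrot d : tail (vrot d) = tail d.
Proof. by apply/esym/tailP; exists 1%N. Qed.

Lemma tail_vprev d : tail (vprev d) = tail d.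
Proof. by rewrite -[in RHS](vprevK d) tail_vrot. Qed.

Lemma tail_iter_vrot n d : tail (iter n (@vrot G) d) = tail d.
Proof. by elim: n => //= n IH; rewrite tail_vrot. Qed.

Lemma tail_fnext d : tail (fnext d) = tip d.
Proof. by rewrite -tail_vrot /vrot fnextK. Qed.

Lemma lface_fprev d : lface (fprev d) = lface d.
Proof. by rewrite -{2}(fprevK d) lface_fnext. Qed.

Lemma lface_vprev d : lface (vprev d) = lface (flip d).
Proof. by rewrite lface_fnext. Qed.

Lemma lface_flip_vrot d : lface (flip (vrot d)) = lface d.
Proof. by rewrite /vrot flipK lface_fprev. Qed.

Lemma interior_vertexP u d : interior_vertex u -> tail d = u -> interior_dart d.
Proof.
by move=> hu du; split; [|rewrite -lface_vprev]; apply: hu; rewrite ?tail_vprev.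
Qed.

(** By [tailP] the clockwise neighbour [vprev d] lies on the forward orbit of [d], so the orbit is a
    cycle; taking the least period excludes repetitions. *)
Lemma vrot_period d : exists N, [/\ iter N.+1 (@vrot G) d = d,
  uniq (traject (@vrot G) d N.+1) &
  forall d', tail d' = tail d -> d' \in traject (@vrot G) d N.+1].
Proof.
have hN : exists n, iter n.+1 (@vrot G) d == d.
  have [n hn] : exists n, vprev d = iter n (@vrot G) d.
    by apply/tailP; rewrite tail_vprev.
  by exists n; rewrite iterS -hn vprevK.
have iterI n : injective (iter n (@vrot G)).
  by elim: n => //= n IH x y /(can_inj vrotK)/IH.
case: (ex_minnP hN) => N /eqP NE Nmin; exists N; split => //.
- rewrite looping_uniq; apply/trajectP => -[i iN /esym E].
  have := Nmin (N - i).-1.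
  rewrite prednK ?subn_gt0//.
  have -> : iter (N - i) (@vrot G) d == d.
    by apply/eqP/(iterI i); rewrite -iterD subnKC ?E// ltnW.
  by move=> /(_ isT); rewrite leqNgt prednK ?subn_gt0// leq_subr.
- move=> d' /esym/tailP[n ->]; apply/trajectP; exists (n %% N.+1)%N.
    by rewrite ltn_mod.
  rewrite {1}(divn_eq n N.+1) addnC iterD; congr (iter _ _ _).
  by elim: (n %/ _)%N => [//|k IH]; rewrite mulSn addnC iterD NE.
Qed.

Lemma finite_star u : finite_set (star u).
Proof.
have [d <-] := tail_surj u; have [N [_ _ hN]] := vrot_period d.
apply: (sub_finite_set _ (finite_seq (traject (@vrot G) d N.+1))).
by move=> d' /= /hN.
Qed.

Section Sums.
Variable V : nmodType.

Lemma star_sum (F : dart G -> V) d N :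
  uniq (traject (@vrot G) d N) ->
  (forall d', tail d' = tail d -> d' \in traject (@vrot G) d N) ->
  \sum_(e \in star (tail d)) F e = \sum_(k < N) F (iter k (@vrot G) d).
Proof.
move=> uN hN; rewrite (_ : star _ = [set` traject (@vrot G) d N]).
  rewrite -fsbig_seq// (big_nth d) size_traject big_mkord.
  by apply: eq_bigr => i _; rewrite nth_traject.
apply/seteqP; split=> e /=; first exact: hN.
by case/trajectP => i _ ->; exact: tail_iter_vrot.
Qed.

Lemma star_sum_vprev (F : dart G -> V) u :
  \sum_(d \in star u) F (vprev d) = \sum_(d \in star u) F d.
Proof.
apply/esym/reindex_fsbig; split.
- by move=> d <-; rewrite /star /= tail_vprev.
- by move=> d d' _ _; exact: (can_inj vprevK).
- by move=> d /= du; exists (vrot d); rewrite ?vrotK // /star /= tail_vrot.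
Qed.

End Sums.

Lemma star_sumB (V : zmodType) (A B : dart G -> V) u :
  \sum_(d \in star u) (A d - B d) =
  \sum_(d \in star u) A d - \sum_(d \in star u) B d.
Proof. by rewrite !fsbig_finite ?sumrB//; exact: finite_star. Qed.

Lemma star_telescope (V : zmodType) (A : dart G -> V) u :
  \sum_(d \in star u) (A d - A (vprev d)) = 0.
Proof. by rewrite star_sumB star_sum_vprev subrr. Qed.

Section Exactness.
Variables (V : zmodType) (eta : dart G -> V).
Hypothesis eta_flip : forall d, interior_dart d -> eta (flip d) = - eta d.
Hypothesis eta_star : forall u, interior_vertex u ->
  \sum_(d \in star u) eta d = 0.

(** Around each vertex separately a primitive exists: start from any corner at
    an interior vertex, and from the gap in the fan at a boundary vertex. *)
Lemma star_primitive u : exists phi : dart G -> V, forall d, tail d = u ->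
  interior_dart d -> phi d - phi (vprev d) = eta d.
Proof.
have [d0 [d0u hd0]] : exists d, tail d = u /\
    (interior_vertex u \/ lface d = None).
  have [hu|/existsNP[d /not_implyP[du /contrapT dN]]] :=
    pselect (interior_vertex u).
    by have [d du] := tail_surj u; exists d; split=> //; left.
  by exists d; split=> //; right.
have [N [NE uN hN]] := vrot_period d0.
set s := traject _ _ _ in uN hN.
(* The jump across [d0] itself is left out: at an interior vertex the vanishing sum over the star
   forces it, otherwise [d0] has no left face and imposes no condition. *)
pose phi d := \sum_(k < index d s) eta (iter k.+1 (@vrot G) d0).
have phiE j : (j <= N)%N -> phi (iter j (@vrot G) d0) =
    \sum_(k < j) eta (iter k.+1 (@vrot G) d0).
  move=> jN; rewrite /phi -(nth_traject _ (jN : (j < N.+1)%N)) index_uniq//.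
  by rewrite size_traject.
exists phi => d du dint.
have /trajectP[[|j] jN dE] : d \in s by apply: hN; rewrite du d0u.
- case: hd0 => [hu|]; last by rewrite -[d0]dE => d0N; case: dint.
  have -> : vprev d = iter N (@vrot G) d0 by rewrite dE -{1}NE iterS vrotK.
  rewrite {1}dE !phiE// big_ord0 sub0r; apply/eqP.
  rewrite eq_sym -addr_eq0 dE /=.
  have := eta_star hu; rewrite -d0u (star_sum _ uN hN) big_ord_recl /= => E0.
  exact/eqP.
- rewrite dE [iter j.+1 _ _]iterS vrotK -iterS !phiE//;
    last exact: (ltnW (jN : (j < N)%N)).
  by rewrite big_ord_recr/= addrAC subrr add0r.
Qed.

Hypothesis hG : simply_connected G.

Section Cocycle.
Variable h : dart G -> V.
Hypothesis h_flip : forall d, h (flip d) = - h d.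
Hypothesis h_face : forall d n, lface d <> None -> iter n (@fnext G) d = d ->
  \sum_(e <- traject (@fnext G) d n) h e = 0.

(** Backtracks contribute zero by [h_flip], inserted face boundaries by [h_face]. *)
Lemma homotopic_sum u v p q : homotopic u v p q ->
  \sum_(e <- p) h e = \sum_(e <- q) h e.
Proof.
elim=> //.
- by move=> p1 q1 r1 _ -> _ ->.
- move=> p1 q1 d _ _.
  by rewrite !big_cat /= !big_cons big_nil addr0 h_flip subrr add0r.
- move=> p1 q1 d n dl dn _ _.
  by rewrite !big_cat /= (h_face dl dn) add0r.
Qed.

Lemma walk_cat u v w (p q : seq (dart G)) :
  walk u v p -> walk v w q -> walk u w (p ++ q).
Proof.
elim: p u => [|d p IH] u /=; first by move=> ->.
by case=> -> hp hq; split=> //; exact: IH.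
Qed.

(** Sum [h] along a chosen path from [u0] to each vertex. One common return path [q] closes the
    paths to [tail d] and [tip d] into two null-homotopic loops, which compares the sums. *)
Lemma cocycle_exact : exists c : vertex G -> V,
  forall d, c (tip d) = c (tail d) + h d.
Proof.
have [conn triv] := hG.
have [[u0]|noV] := pselect (inhabited (vertex G)); last first.
  by exists (fun=> 0) => d; case: noV; exists; exact: tail d.
have [p hp] := choice (conn u0).
exists (fun u => \sum_(e <- p u) h e) => d.
have [q hq] := conn (tip d) u0.
have hd : walk (tail d) u0 (d :: q) by [].
have := homotopic_sum (triv _ _ (walk_cat (hp (tail d)) hd)).
have := homotopic_sum (triv _ _ (walk_cat (hp (tip d)) hq)).
rewrite !big_cat big_cons big_nil => E1 E2.
by apply: (addIr (\sum_(e <- q) h e)); rewrite -addrA E1 E2.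
Qed.

End Cocycle.

(** The local primitives [phi] differ from a global one by a constant [c u] at
    each vertex [u]; along an edge these constants jump by the cocycle [h]. *)
Lemma dual_form_exact : exists F : face G -> V,
  forall d l r, lface d = Some l -> lface (flip d) = Some r ->
    F l - F r = eta d.
Proof.
have [phi0 hphi0] := choice star_primitive.
pose phi d := phi0 (tail d) d.
have hphi d : interior_dart d -> phi d - phi (vprev d) = eta d.
  by move=> di; rewrite /phi tail_vprev; exact: hphi0.
(* [phi d] belongs to the corner of the left face at [tail d], and [h d] compares the corners of one
   face at the two ends of [d]. A dart without left face uses its right face; at interior darts both
   faces give the same value because [eta] is odd. *)
pose h d := if lface d is Some _ then phi d - phi (fnext d)
            else phi (vprev d) - phi (flip d).
have h_flip d : h (flip d) = - h d.
  rewrite /h flipK /vprev flipK.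
  case dl : (lface d) => [l|]; case dr : (lface (flip d)) => [r|].
  - have di : interior_dart d by rewrite /interior_dart dl dr.
    have := hphi _ di; have := hphi _ (flip_interior di).
    rewrite eta_flip // => E1 E2; move: E1; rewrite -E2 /vprev flipK opprB.
    move=> /eqP; rewrite subr_eq => /eqP ->.
    by rewrite addrAC [_ - phi d]addrC addrK opprB addrC.
  - by rewrite opprB.
  - by rewrite opprB.
  - by case: (edge_in_face dl).
have h_face d n : lface d <> None -> iter n (@fnext G) d = d ->
    \sum_(e <- traject (@fnext G) d n) h e = 0.
  move=> dl; have hE e : lface e = lface d -> h e = phi e - phi (fnext e).
    by rewrite /h => ->; case: (lface d) dl.
  move=> dn; rewrite -[RHS](subrr (phi d)) -{3}dn.
  elim: n d {dn} dl hE => [|n IH] d dl hE; first by rewrite big_nil subrr.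
  rewrite /= big_cons hE// IH ?lface_fnext// -?iterSr ?iterS ?addrA ?subrK//.
have [c hc] := cocycle_exact h_flip h_face.
have [df hdf] := choice (@lface_surj G).
(* After the correction by [c] the corner values are constant around each face, so any dart [df f]
   can represent the face. *)
pose F0 d := phi d + c (tail d).
have F0_fnext d : lface d <> None -> F0 (fnext d) = F0 d.
  move=> dl; rewrite /F0 tail_fnext hc /h; case: (lface d) dl => // l _.
  by rewrite addrCA [phi (fnext d) + _]addrC subrK addrC.
have F0E f d : lface d = Some f -> F0 (df f) = F0 d.
  have lf n : lface (iter n (@fnext G) (df f)) = Some f.
    by elim: n => [|n IH] /=; rewrite ?lface_fnext ?hdf.
  move=> /(lfaceP (hdf f))[n ->]; elim: n => //= n ->.
  by rewrite F0_fnext ?lf.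
exists (fun f => F0 (df f)) => d l r dl dr.
rewrite (F0E _ _ dl) -lface_vprev in dr *; rewrite (F0E _ _ dr) /F0 tail_vprev.
by rewrite opprD addrACA subrr addr0 hphi// /interior_dart -lface_vprev dl dr.
Qed.

End Exactness.
End Topology.

(** * Poles of circles *)

Section Vec3.
Variable T : comNzRingType.
Implicit Types (v w : 'rV[T]_3).

Lemma vec3_eta v : v = vec3 (v 0 (inord 0)) (v 0 (inord 1)) (v 0 (inord 2)).
Proof.
apply/rowP => j; rewrite mxE; rewrite -[j]inord_val.
by case: j => -[|[|[|]]] //= _; rewrite inordK.
Qed.

Lemma vec3P (P : 'rV[T]_3 -> Prop) : (forall a b c, P (vec3 a b c)) -> forall v, P v.
Proof. by move=> h v; rewrite (vec3_eta v). Qed.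

Lemma vec3_inj (a b c a' b' c' : T) :
  vec3 a b c = vec3 a' b' c' -> [/\ a = a', b = b' & c = c'].
Proof.
move=> /rowP E; have := E (inord 0); have := E (inord 1); have := E (inord 2).
by rewrite !mxE !inordK.
Qed.

Lemma vec3D (a b c a' b' c' : T) :
  vec3 a b c + vec3 a' b' c' = vec3 (a + a') (b + b') (c + c').
Proof. by apply/rowP => -[[|[|[|]]]] //= ?; rewrite !mxE. Qed.

Lemma vec3N (a b c : T) : - vec3 a b c = vec3 (- a) (- b) (- c).
Proof. by apply/rowP => -[[|[|[|]]]] //= ?; rewrite !mxE. Qed.

Lemma vec3Z (k a b c : T) : k *: vec3 a b c = vec3 (k * a) (k * b) (k * c).
Proof. by apply/rowP => -[[|[|[|]]]] //= ?; rewrite !mxE. Qed.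

Lemma vec3_0 : 0 = vec3 0 0 0 :> 'rV[T]_3.
Proof. by apply/rowP => -[[|[|[|]]]] //= ?; rewrite !mxE. Qed.

Lemma dot_vec3 (a b c a' b' c' : T) :
  dot (vec3 a b c) (vec3 a' b' c') = a * a' + b * b' + c * c'.
Proof. by rewrite /dot !big_ord_recl big_ord0 !mxE /= addr0 addrA. Qed.

Lemma cross_vec3 (a b c a' b' c' : T) :
  cross (vec3 a b c) (vec3 a' b' c') =
  vec3 (b * c' - c * b') (c * a' - a * c') (a * b' - b * a').
Proof. by rewrite /cross !mxE !inordK. Qed.

End Vec3.

Lemma map_vec3 (S T : comNzRingType) (f : S -> T) (a b c : S) :
  map_mx f (vec3 a b c) = vec3 (f a) (f b) (f c).
Proof. by apply/rowP => -[[|[|[|]]]] //= ?; rewrite !mxE. Qed.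

Section Geometry.
Variable R : realType.
Implicit Types (z : R[i]) (A B : circle R).

(** The integrand of the Weierstrass representation, a null vector of the bilinear form [dot]. Hence
    the real and imaginary parts of its multiples are orthogonal and of equal length. *)
Definition weierstrass_vector z : 'rV[R[i]]_3 :=
  vec3 (1 - z ^+ 2) ('i%C * (1 + z ^+ 2)) (2 * z).

Definition re_vec (v : 'rV[R[i]]_3) : 'rV[R]_3 := map_mx (@complex.Re R) v.
Definition im_vec (v : 'rV[R[i]]_3) : 'rV[R]_3 := map_mx (@complex.Im R) v.

Lemma re_weierstrass (a b x y : R) :
  re_vec ((a +i* b) *: weierstrass_vector (x +i* y)) =
  vec3 (a * (1 - (x ^+ 2 - y ^+ 2)) + 2 * b * x * y)
       (- (2 * a * x * y) - b * (1 + (x ^+ 2 - y ^+ 2)))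
       (2 * a * x - 2 * b * y).
Proof.
rewrite vec3Z /re_vec map_vec3 !expr2; congr vec3; rewrite /=; ring.
Qed.

Lemma im_weierstrass (a b x y : R) :
  im_vec ((a +i* b) *: weierstrass_vector (x +i* y)) =
  vec3 (b * (1 - (x ^+ 2 - y ^+ 2)) - 2 * a * x * y)
       (a * (1 + (x ^+ 2 - y ^+ 2)) - 2 * b * x * y)
       (2 * a * y + 2 * b * x).
Proof.
rewrite vec3Z /im_vec map_vec3 !expr2; congr vec3; rewrite /=; ring.
Qed.

Implicit Types (w p : R[i]).

Lemma sqr_norm_gt0 (x y : R) : 0 < 1 + (x ^+ 2 + y ^+ 2).
Proof. by rewrite ltr_pwDl// addr_ge0// sqr_ge0. Qed.

(** Both parts are tangent to the sphere at the unit vector [stereo z], so crossing with that vector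
    is a quarter turn of the tangent plane. *)
Lemma cross_re_stereo (k z : R[i]) :
  cross (re_vec (k *: weierstrass_vector z)) (stereo z) =
  im_vec (k *: weierstrass_vector z).
Proof.
case: z k => [x y] [a b].
rewrite re_weierstrass im_weierstrass /stereo /= vec3Z cross_vec3.
have := lt0r_neq0 (sqr_norm_gt0 x y) => n0.
by congr vec3; field.
Qed.

Lemma cross_im_stereo (k z : R[i]) :
  cross (im_vec (k *: weierstrass_vector z)) (stereo z) =
  - re_vec (k *: weierstrass_vector z).
Proof.
case: z k => [x y] [a b].
rewrite re_weierstrass im_weierstrass /stereo /= vec3Z cross_vec3 vec3N.
have := lt0r_neq0 (sqr_norm_gt0 x y) => n0.
by congr vec3; field.
Qed.

Lemma dot_re_im_weierstrass (k z : R[i]) :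
  dot (re_vec (k *: weierstrass_vector z)) (re_vec (k *: weierstrass_vector z)) =
  dot (im_vec (k *: weierstrass_vector z)) (im_vec (k *: weierstrass_vector z)).
Proof.
case: z k => [x y] [a b].
by rewrite re_weierstrass im_weierstrass !dot_vec3; ring.
Qed.

Lemma dot_eq0 (v : 'rV[R]_3) : dot v v = 0 -> v = 0.
Proof.
rewrite (vec3_eta v) dot_vec3 -!expr2 vec3_0; set a := v _ _; set b := v _ _.
set c := v _ _ => E; congr vec3; apply/eqP; rewrite -sqrf_eq0; apply/eqP.
all: have := sqr_ge0 a; have := sqr_ge0 b; have := sqr_ge0 c; lra.
Qed.

(** Having equal lengths, the two parts could only vanish together, but the last entry of the
    Weierstrass vector is zero only at [z = 0], where the first is 1. *)
Lemma im_weierstrass_neq0 (k z : R[i]) :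
  k != 0 -> im_vec (k *: weierstrass_vector z) != 0.
Proof.
move=> k0; apply/eqP => I0.
have R0 : re_vec (k *: weierstrass_vector z) = 0.
  apply: dot_eq0; rewrite dot_re_im_weierstrass I0 vec3_0 dot_vec3.
  by rewrite !mulr0 !addr0.
have W0 : weierstrass_vector z = 0.
  apply: (scalerI k0); rewrite scaler0; apply/rowP => j; apply/eqP.
  move/rowP/(_ j): R0; move/rowP/(_ j): I0; rewrite !mxE eq_complex /=.
  by move=> -> ->; rewrite eqxx.
move: W0; rewrite /weierstrass_vector vec3_0 => /vec3_inj[+ _ /eqP].
rewrite mulf_eq0 pnatr_eq0 /= => /[swap] /eqP ->.
by rewrite expr0n subr0 => /eqP; rewrite oner_eq0.
Qed.

Lemma re_weierstrass_neq0 (k z : R[i]) :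
  k != 0 -> re_vec (k *: weierstrass_vector z) != 0.
Proof.
move=> k0; apply: contraNneq (im_weierstrass_neq0 z k0) => R0.
apply/eqP/dot_eq0; rewrite -dot_re_im_weierstrass R0 vec3_0 dot_vec3.
by rewrite !mulr0 !addr0.
Qed.

Lemma on_circleE A w : on_circle A w <->
  (complex.Re w - complex.Re (center A)) ^+ 2 +
  (complex.Im w - complex.Im (center A)) ^+ 2 = radius A ^+ 2.
Proof.
rewrite /on_circle /= normc_def; case: w (center A) => x y [a b] /=.
set n := (_ + _); have n0 : 0 <= n by rewrite addr_ge0 ?sqr_ge0.
split=> [[<-]|->]; first by rewrite sqr_sqrtr.
by rewrite sqrtr_sqr gtr0_norm// radius_gt0.
Qed.

Lemma open_diskE A w : open_disk A w <->
  (complex.Re w - complex.Re (center A)) ^+ 2 +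
  (complex.Im w - complex.Im (center A)) ^+ 2 < radius A ^+ 2.
Proof.
rewrite /open_disk /= normc_def; case: w (center A) => x y [a b] /=.
set n := (_ + _); have n0 : 0 <= n by rewrite addr_ge0 ?sqr_ge0.
rewrite ltcR; have r0 := radius_gt0 A.
by rewrite -{2}(sqr_sqrtr n0) ltr_pXn2r// nnegrE ?sqrtr_ge0// ltW.
Qed.

Lemma tangent_at_neq A w : ~ tangent_at A A w.
Proof.
move=> /seteqP[h _]; have r0 := radius_gt0 A.
case: A r0 h => -[a b] r rp /= r0 h.
have h1 : ((a + r) +i* b) = w.
  by apply: h; split; apply/on_circleE => /=; ring.
have : ((a - r) +i* b) = w.
  by apply: h; split; apply/on_circleE => /=; ring.
by rewrite -h1 => -[]; lra.
Qed.

(** Multiplied by [1 + |w|^2], the polar plane condition is a circle equation in the plane. Its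
    values at the four extreme points of [A] determine the coefficients. *)
Lemma pole_coords (a b c : R) A : pole_of (vec3 a b c) A ->
  let p := complex.Re (center A) in let q := complex.Im (center A) in
  [/\ 1 - c != 0, a = (1 - c) * p, b = (1 - c) * q &
      1 + c = (1 - c) * (p ^+ 2 + q ^+ 2 - radius A ^+ 2)].
Proof.
have r0 := radius_gt0 A; case: A r0 => -[p q] r rp /= r0 h.
have E x y : (x - p) ^+ 2 + (y - q) ^+ 2 = r ^+ 2 ->
    2 * a * x + 2 * b * y - (1 - c) * (x ^+ 2 + y ^+ 2) - (1 + c) = 0.
  move=> xy; have := h (x +i* y); rewrite on_circleE /= => /(_ xy).
  rewrite /stereo /= vec3Z dot_vec3.
  have n0 := lt0r_neq0 (sqr_norm_gt0 x y) => /eqP; rewrite -subr_eq0 => /eqP.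
  move=> /(congr1 ( *%R (1 + (x ^+ 2 + y ^+ 2)))); rewrite mulr0 => <-; field.
  exact: n0.
have E1 := E (p + r) q ltac:(ring); have E2 := E (p - r) q ltac:(ring).
have E3 := E p (q + r) ltac:(ring); have E4 := E p (q - r) ltac:(ring).
have ea : a = (1 - c) * p by apply: (mulfI (lt0r_neq0 r0)); lra.
have eb : b = (1 - c) * q by apply: (mulfI (lt0r_neq0 r0)); lra.
have ec : 1 + c = (1 - c) * (p ^+ 2 + q ^+ 2 - r ^+ 2).
  by move: E1 E2; rewrite ea eb; lra.
split=> //; apply/eqP => c1; move: ec; rewrite c1 mul0r; lra.
Qed.

(** Since [1 - c] is nonzero, the planar equation can be divided back into the equation of [A]. Thus
    a pole determines its circle. *)
Lemma pole_on_circle N A w :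
  pole_of N A -> dot N (stereo w) = 1 -> on_circle A w.
Proof.
move: N; apply: vec3P => a b c /pole_coords[c1 ea eb ec].
rewrite on_circleE; case: w => x y; rewrite /stereo vec3Z dot_vec3 /= => /eqP.
rewrite -subr_eq0 => /eqP E; have n0 := lt0r_neq0 (sqr_norm_gt0 x y).
apply: (mulfI c1); apply/eqP; rewrite -subr_eq0; apply/eqP.
move/(congr1 ( *%R (1 + (x ^+ 2 + y ^+ 2)))): E.
set r := radius A in ec *; set p := complex.Re _ in ea ec *.
set q := complex.Im _ in eb ec *; rewrite mulr0 => E.
have {}E : 2 * a * x + 2 * b * y - (1 - c) * (x ^+ 2 + y ^+ 2) - (1 + c) = 0.
  by rewrite -E; field.
by move: E; rewrite ea eb; lra.
Qed.

Lemma pole_neq N N' A B w : pole_of N A -> pole_of N' B -> tangent_at A B w ->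
  N != N'.
Proof.
move=> NA NB; apply: contraPneq => NN'; rewrite -NN' in NB.
suff -> : tangent_at A B w = tangent_at A A w by exact: tangent_at_neq.
rewrite /tangent_at; congr (_ `&` _ = _).
by apply/seteqP; split=> v; [move=> /NB/(pole_on_circle NA)|
  move=> /NA/(pole_on_circle NB)].
Qed.

(** [2 Re (p^* W(z)) / (1 + |z|^2)^2] is the differential of [stereo] at [z] in
    the direction [p]. *)
Lemma pole_offset N A z : pole_of N A -> on_circle A z -> exists k : R,
  N = stereo z + k *: re_vec ((center A - z)^*%C *: weierstrass_vector z).
Proof.
move: N; apply: vec3P => a b c /pole_coords[c1 ea eb ec] /on_circleE.
case: (center A) ea eb ec => p q /= ea eb ec; case: z => x y /= hz.
exists ((1 - c) / (1 + (x ^+ 2 + y ^+ 2))).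
have n0 := lt0r_neq0 (sqr_norm_gt0 x y).
rewrite re_weierstrass /stereo /= !vec3Z vec3D; rewrite -hz in ec.
(* This is the sum of [1 - c] and [1 + c], with the radius eliminated by the circle equation. *)
have e2 : 2 = (1 - c) * (1 + 2 * p * x + 2 * q * y - (x ^+ 2 + y ^+ 2)).
  by move: ec; lra.
congr vec3; apply: (mulfI n0); rewrite mulrDr !mulrA !mulfV// !mul1r.
all: rewrite [_ * (1 - c) / _]mulrAC mulfV// mul1r ?ea ?eb.
- by move/(congr1 ( *%R x)): e2; lra.
- by move/(congr1 ( *%R y)): e2; lra.
- by move: ec; lra.
Qed.

(** Inversion in a circle centered at [z] maps [A] to a line. *)
Lemma Re_inv_on_circle A z w : on_circle A z -> on_circle A w -> w != z ->
  complex.Re ((center A - z) / (w - z)) = 1 / 2.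
Proof.
move=> /on_circleE + /on_circleE.
case: (center A) => p q; case: z => x y; case: w => a b /= hz hw.
rewrite eq_complex /= => wz.
have n0 : (a - x) ^+ 2 + (b - y) ^+ 2 != 0.
  rewrite paddr_eq0 ?sqr_ge0// !sqrf_eq0 !subr_eq0; exact: wz.
apply: (mulfI n0); rewrite -hz in hw.
suff -> : ((a - x) ^+ 2 + (b - y) ^+ 2) *
    ((p - x) * ((a - x) / ((a - x) ^+ 2 + (b - y) ^+ 2)) -
    (q - y) * - ((b - y) / ((a - x) ^+ 2 + (b - y) ^+ 2))) =
    (p - x) * (a - x) + (q - y) * (b - y).
  by move: hw; lra.
by field.
Qed.

(** For nonzero [p] the solutions of [Re (p * v) = 0] form a single real line. *)
Lemma Re_mul_eq0_proportional p v w : p != 0 -> w != 0 ->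
  complex.Re (p * v) = 0 -> complex.Re (p * w) = 0 ->
  exists t : R, v = t%:C * w.
Proof.
case: p v w => p q [a b] [x y]; rewrite !eq_complex /= => p0 w0 E1 E2.
have n0 : x ^+ 2 + y ^+ 2 != 0 by rewrite paddr_eq0 ?sqr_ge0// !sqrf_eq0.
have m0 : p ^+ 2 + q ^+ 2 != 0 by rewrite paddr_eq0 ?sqr_ge0// !sqrf_eq0.
have D : a * y = b * x.
  apply: (mulfI m0).
  move: E1 E2 => /(congr1 ( *%R (p * y + q * x))) + /(congr1 ( *%R (p * b + q * a))).
  by lra.
exists ((a * x + b * y) / (x ^+ 2 + y ^+ 2)); apply/eqP; rewrite eq_complex /=.
rewrite !mul0r subr0 addr0; apply/andP; split; apply/eqP/(mulfI n0).
all: rewrite ![_ * (_ / _ * _)]mulrA [_ * (_ / _)]mulrCA mulfV// mulr1.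
- have -> : (x ^+ 2 + y ^+ 2) * a = x * (a * x) + y * (a * y) by ring.
  by rewrite D; ring.
- have -> : (x ^+ 2 + y ^+ 2) * b = x * (b * x) + y * (b * y) by ring.
  by rewrite -D; ring.
Qed.

(** Orthogonal nonzero [p] and [q] form a real basis of the plane, and the conjugate of [v] is
    orthogonal to both. *)
Lemma Re_orthogonal_eq0 p q v : p != 0 -> q != 0 -> complex.Re (p * q^*%C) = 0 ->
  complex.Re (p * v) = 0 -> complex.Re (q * v) = 0 -> v = 0.
Proof.
move=> p0 q0 pq pv qv.
have qC0 : q^*%C != 0 by rewrite conjc_eq0.
have [t vE] := Re_mul_eq0_proportional p0 qC0 pv pq.
move: qv; rewrite vE; case: q q0 {pq qC0 vE} => a b.
rewrite eq_complex /= => ab0 E; suff -> : t = 0 by rewrite mul0r.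
have n0 : a ^+ 2 + b ^+ 2 != 0 by rewrite paddr_eq0 ?sqr_ge0// !sqrf_eq0.
by apply: (mulfI n0); move: E; lra.
Qed.

Lemma center_neq A w : on_circle A w -> center A - w != 0.
Proof.
move=> /on_circleE E; apply/eqP => /(congr1 (fun z => (complex.Re z, complex.Im z))).
case: (center A) w E => a b [x y] /= E [E1 E2].
have := exprn_gt0 2 (radius_gt0 A).
by rewrite -E -[x - a]opprB -[y - b]opprB E1 E2 oppr0 expr0n addr0 ltxx.
Qed.

Lemma proportional_centers_meet A B w (t : R) : 0 < t ->
  on_circle A w -> on_circle B w -> center B - w = t%:C * (center A - w) ->
  open_disk A `&` open_disk B !=set0.
Proof.
(* Moving from [w] by the fraction [s] towards the center of [A] stays inside [A] for [0 < s < 2]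
   and inside [B] for [0 < s < 2 * t]; this [s] is below both 1 and [t]. *)
move=> t0 wA wB E; set s := t / (1 + t).
have t1 : 0 < 1 + t by rewrite addr_gt0.
have s0 : 0 < s by rewrite divr_gt0.
have s1 : s < 1 by rewrite ltr_pdivrMr// mul1r ltrDr.
have st : s < t by rewrite ltr_pdivrMr// mulrDr mulr1 ltrDl mulr_gt0.
exists (w + s%:C * (center A - w)); clearbody s; have P := center_neq wA.
move: wA wB P => /on_circleE wA /on_circleE wB P.
split; apply/open_diskE; rewrite -?wA -?wB; move: E P => {wA wB};
  case: (center A) (center B) => a b [c d]; case: w => x y /eqP;
  rewrite !eq_complex /= => /andP[/eqP E1 /eqP E2] P;
  have n0 : 0 < (a - x) ^+ 2 + (b - y) ^+ 2
    by rewrite lt0r paddr_eq0 ?sqr_ge0// !sqrf_eq0 P addr_ge0// sqr_ge0.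
- have : 0 < s * (2 - s) * ((a - x) ^+ 2 + (b - y) ^+ 2).
    by rewrite !mulr_gt0//; lra.
  by lra.
- have -> : c = x + t * (a - x) by lra.
  have -> : d = y + t * (b - y) by lra.
  have : 0 < s * (2 * t - s) * ((a - x) ^+ 2 + (b - y) ^+ 2).
    by rewrite !mulr_gt0//; lra.
  by lra.
Qed.

(** Of three circles tangent to a common line at [z], two lie on the same side. *)
Lemma three_tangent_circles (A B B' : circle R) p z : p != 0 ->
  on_circle A z -> on_circle B z -> on_circle B' z ->
  complex.Re (p * (center A - z)) = 0 -> complex.Re (p * (center B - z)) = 0 ->
  complex.Re (p * (center B' - z)) = 0 ->
  open_disk A `&` open_disk B = set0 -> open_disk A `&` open_disk B' = set0 ->
  open_disk B `&` open_disk B' <> set0.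
Proof.
move=> p0 zA zB zB' pA pB pB' dB dB'.
have [t tE] := Re_mul_eq0_proportional p0 (center_neq zA) pB pA.
have [t' t'E] := Re_mul_eq0_proportional p0 (center_neq zA) pB' pA.
have t0 : t < 0.
  have := center_neq zB; rewrite tE mulf_eq0 negb_or => /andP[+ _].
  rewrite eq_complex /= eqxx andbT => tn0.
  rewrite lt_neqAle tn0 leNgt /=; apply/negP => t0.
  by have := proportional_centers_meet t0 zA zB tE; rewrite dB => -[].
have t'0 : t' < 0.
  have := center_neq zB'; rewrite t'E mulf_eq0 negb_or => /andP[+ _].
  rewrite eq_complex /= eqxx andbT => tn0.
  rewrite lt_neqAle tn0 leNgt /=; apply/negP => t'_0.
  by have := proportional_centers_meet t'_0 zA zB' t'E; rewrite dB' => -[].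
apply/eqP/set0P; apply: (@proportional_centers_meet _ _ z (t' / t)) => //.
  by rewrite nmulr_rgt0// invr_lt0.
rewrite tE t'E mulrA; congr (_ * _).
by rewrite -rmorphM /= divfK// lt_eqF.
Qed.

End Geometry.

(** * The Weierstrass form on the dual edges *)

Section Packing.
Variables (R : realType) (G : cell_decomposition) (C : circle_packing R G).
Implicit Types (d : dart G).

Lemma tp_flip d : tp C (flip d) = tp C d.
Proof.
have := circ_tangent C d; have := circ_tangent C (flip d).
rewrite tip_flip -/(tip d) /tangent_at setIC => -> /seteqP[h _].
exact: (h (tp C (flip d)) erefl).
Qed.

Lemma tip_neq d : tail d <> tip d.
Proof. by move=> E; have := circ_tangent C d; rewrite -E => /tangent_at_neq. Qed.

Lemma tp_fprev d : tp C (fprev d) = tp C (vrot d).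
Proof. by rewrite tp_flip. Qed.

Lemma on_circ_tail d : on_circle (circ C (tail d)) (tp C d).
Proof. by have /seteqP[_ /(_ _ erefl)[]] := circ_tangent C d. Qed.

Lemma on_circ_tip d : on_circle (circ C (tip d)) (tp C d).
Proof. by have /seteqP[_ /(_ _ erefl)[]] := circ_tangent C d. Qed.

Lemma ccw_neq (a b c : R[i]) : ccw a b c -> [/\ a != b, a != c & b != c].
Proof.
case: a b c => a a' [b b'] [c c']; rewrite /ccw /= => h.
by split; apply: contraTneq h => -[-> ->]; rewrite -leNgt; lra.
Qed.

Variable D : dual_packing C.

Lemma dual_center_orthogonal d l : lface d = Some l ->
  [/\ on_circle (dcirc D l) (tp C d),
   complex.Re ((center (dcirc D l) - tp C d) *
     (center (circ C (tail d)) - tp C d)^*%C) = 0 &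
   complex.Re ((center (dcirc D l) - tp C d) *
     (center (circ C (tip d)) - tp C d)^*%C) = 0].
Proof.
move=> /(dual_orthogonal D)[[dz _ h1] [_ _ h2]]; split => //.
- by rewrite -h1 -[in RHS]opprB mulNr -mulrN -rmorphN opprB.
- by rewrite -h2 -[in RHS]opprB mulNr -mulrN -rmorphN opprB.
Qed.

(** At a vertex of degree one the same face would lie on both sides of the edge, and its circle
    would be tangent to itself. *)
Lemma vrot_neq d : interior_dart d -> vrot d <> d.
Proof.
case; case dl : (lface d) => [l|//] _; case dr : (lface (flip d)) => [r|//] _ E.
have : lface (flip d) = lface d by rewrite -{1}E lface_flip_vrot.
rewrite dr dl => -[rl]; rewrite rl in dr.
by have := dual_tangent D dl dr; exact: tangent_at_neq.
Qed.

(** At a vertex of degree two both edges separate the same two faces, whose circles touch only once,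
    so the two tangency points coincide. The circle of the vertex and those of its two neighbours
    would then share a tangent line at one point. *)
Lemma vrot2_neq d : interior_dart d -> vrot (vrot d) <> d.
Proof.
move=> di E; have dd' := vrot_neq di; set d' := vrot d in E dd'.
case: di; case dl : (lface d) => [l|//] _; case dr : (lface (flip d)) => [r|//] _.
have d'r : lface d' = Some r.
  by rewrite -(vrotK d') E lface_vprev dr.
have d'l : lface (flip d') = Some l by rewrite lface_flip_vrot.
have zz : tp C d' = tp C d.
  have := dual_tangent D dl dr; have := dual_tangent D d'r d'l.
  by rewrite /tangent_at setIC => -> /seteqP[h _]; exact: (h _ erefl).
have tt : tail d' = tail d by rewrite tail_vrot.
have [zl hu hv] := dual_center_orthogonal dl.
have [_ hv' _] := dual_center_orthogonal d'l.
rewrite tp_flip zz -/(tip d') in hv'.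
have ReC (p q : R[i]) : complex.Re (p * q^*%C) = 0 -> complex.Re (p^*%C * q) = 0.
  by case: p q => ? ? [? ?] /=; lra.
apply: (three_tangent_circles _ (on_circ_tail d) (on_circ_tip d) _
          (ReC _ _ hu) (ReC _ _ hv) (ReC _ _ hv')).
- by rewrite conjc_eq0 center_neq.
- by rewrite -zz; exact: on_circ_tip.
- exact/disks_disjoint/tip_neq.
- by apply/disks_disjoint; rewrite -tt; exact: tip_neq.
- by apply/disks_disjoint => /esym/(simple_edges tt)/dd'.
Qed.

(** The degree is at least three, so [d], [vrot d] and [vprev d] are different and the orientation
    condition gives a strict triangle. *)
Lemma tp_neq d : interior_dart d ->
  [/\ tp C (fprev d) != tp C d, tp C (vprev d) != tp C d &
      tp C (vprev d) != tp C (fprev d)].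
Proof.
move=> di; have d1 := vrot_neq di; have d2 := vrot2_neq di.
rewrite tp_fprev; have [] := @ccw_neq (tp C d) (tp C (vrot d)) (tp C (vprev d)).
  apply: circ_oriented; first exact: tail_vprev.
  - by move=> E; apply: d1; rewrite -{2}[d]vprevK E.
  - by move=> E; apply: d2; rewrite -E vprevK.
by move=> h1 h2 h3; split; rewrite eq_sym.
Qed.

(** In this form [1 / omega] is the difference of two points after inversion at [tp C d]. *)
Lemma omega_inv d : interior_dart d ->
  (omega C d)^-1 = (tp C (fprev d) - tp C d)^-1 - (tp C (vprev d) - tp C d)^-1.
Proof.
move=> /tp_neq[h1 h2 h3]; rewrite /omega -/(vprev d).
by field; rewrite !subr_eq0 h1 h2 h3.
Qed.

Lemma omega_neq0 d : interior_dart d -> omega C d != 0.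
Proof.
move=> /tp_neq[h1 h2 h3]; rewrite /omega -/(vprev d).
by rewrite !mulf_neq0 ?invr_eq0 ?subr_eq0.
Qed.

Lemma ReD (p q : R[i]) : complex.Re (p + q) = complex.Re p + complex.Re q.
Proof. by case: p q => ? ? []. Qed.

Lemma ReM_conj (p q : R[i]) : complex.Re (q * p^*%C) = complex.Re (p * q^*%C).
Proof. by case: p q => ? ? [? ?] /=; ring. Qed.

Lemma Re_mul_transfer (q p p' v : R[i]) : q != 0 -> p' != 0 ->
  complex.Re (p * q^*%C) = 0 -> complex.Re (p' * q^*%C) = 0 ->
  complex.Re (p' * v) = 0 -> complex.Re (p * v) = 0.
Proof.
move=> q0 p'0; rewrite ![_ * q^*%C]mulrC => pq p'q E.
have qC0 : q^*%C != 0 by rewrite conjc_eq0.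
have [t ->] := Re_mul_eq0_proportional qC0 p'0 pq p'q.
rewrite -mulrA; case: (p' * v) E => x y /= ->; ring.
Qed.

(** Inversion at [z] sends [A] to a line, and the difference of two image points is along that
    line. *)
Lemma Re_inv_sub (A : circle R) z a b :
  on_circle A z -> on_circle A a -> on_circle A b -> a != z -> b != z ->
  complex.Re ((center A - z) * ((a - z)^-1 - (b - z)^-1)) = 0.
Proof.
move=> zA aA bA az bz.
have := Re_inv_on_circle zA aA az; have := Re_inv_on_circle zA bA bz.
case: (center A - z) (a - z)^-1 (b - z)^-1 => p p' [x x'] [y y'] /=; lra.
Qed.

Lemma circ_omega d : interior_dart d ->
  complex.Re ((center (circ C (tail d)) - tp C d) * (omega C d)^-1) = 0.
Proof.
move=> di; have [h1 h2 _] := tp_neq di; rewrite omega_inv//.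
apply: Re_inv_sub => //; first exact: on_circ_tail.
- by rewrite tp_fprev -(tail_vrot d); exact: on_circ_tail.
- by rewrite -(tail_vprev d); exact: on_circ_tail.
Qed.

(** This is the agreement of the two quotients for [omega]. The sum of the inverses at [d] and
    [flip d] satisfies one real linear condition from the dual circles and one from the packing
    circles; these circles being orthogonal, the sum is zero. *)
Lemma omega_flip d : interior_dart d -> omega C (flip d) = - omega C d.
Proof.
move=> di; have fi := flip_interior di; have [h1 h2 _] := tp_neq di.
have [h3 h4 _] := tp_neq fi; rewrite tp_flip in h3 h4.
rewrite /vprev flipK in h4; set z := tp C d in h1 h2 h3 h4.
apply: invr_inj; rewrite invrN; apply/eqP; rewrite -addr_eq0 addrC; apply/eqP.
case: (di); case dl : (lface d) => [l|//] _; case dr : (lface (flip d)) => [r|//] _.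
have [zl hul hvl] := dual_center_orthogonal dl.
have [+ + +] := dual_center_orthogonal dr.
rewrite tp_flip tip_flip -/(tip d) => zr hvr hur.
have zu := on_circ_tail d; have zv := on_circ_tip d.
have on_dual e f : lface e = Some f -> on_circle (dcirc D f) (tp C e).
  by move=> /dual_center_orthogonal[].
apply: (Re_orthogonal_eq0 (center_neq zl) (center_neq zu) hul).
- rewrite omega_inv// omega_inv// tp_flip {2}/vprev flipK -/z.
  set a := (_ - z)^-1; set b := (_ - z)^-1; set c := (_ - z)^-1; set e := (_ - z)^-1.
  (* [a] and [e] come from points on the left dual circle, [c] and [b] from points on the right
     one. *)
  have -> : a - b + (c - e) = (a - e) + (c - b) by ring.
  rewrite mulrDr ReD (Re_inv_sub zl) ?add0r//; first last.
  + by apply: on_dual; rewrite lface_fnext.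
  + by apply: on_dual; rewrite lface_fprev.
  apply: (Re_mul_transfer (center_neq zu) (center_neq zr) hul hur).
  apply: (Re_inv_sub zr) => //; apply: on_dual.
  + by rewrite lface_fprev.
  + by rewrite lface_vprev.
- rewrite mulrDr ReD circ_omega// add0r.
  apply: (Re_mul_transfer (center_neq zl) (center_neq zv)).
  + by rewrite ReM_conj.
  + by rewrite ReM_conj.
  + by have := circ_omega fi; rewrite tp_flip.
Qed.

Variables (NC : face G -> 'rV[R]_3) (ND : vertex G -> 'rV[R]_3).
Hypothesis hNC : koebe_surface D NC.
Hypothesis hND : dual_koebe_surface C ND.

Definition weierstrass_form d : 'rV[R[i]]_3 :=
  (omega C d)^-1 *: weierstrass_vector (tp C d).

(** The conjugate direction of the dual center and [1 / omega] satisfy the same linear condition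
    given by the circle at [tail d]. Stated without [lface], this serves the left and the right face
    alike. *)
Lemma dual_omega d l : interior_dart d ->
  on_circle (dcirc D l) (tp C d) -> complex.Re ((center (dcirc D l) - tp C d) *
     (center (circ C (tail d)) - tp C d)^*%C) = 0 ->
  exists t : R, (center (dcirc D l) - tp C d)^*%C = t%:C * (omega C d)^-1.
Proof.
move=> di zl hl; have zu := on_circ_tail d.
apply: (Re_mul_eq0_proportional (center_neq zu)).
- by rewrite invr_eq0 omega_neq0.
- by rewrite ReM_conj.
- exact: circ_omega.
Qed.

Lemma koebe_edge d l r : lface d = Some l -> lface (flip d) = Some r ->
  exists a b, [/\ a != b,
    NC l = stereo (tp C d) + a *: re_vec (weierstrass_form d) &
    NC r = stereo (tp C d) + b *: re_vec (weierstrass_form d)].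
Proof.
move=> dl dr; have di : interior_dart d by rewrite /interior_dart dl dr.
have [zl hl _] := dual_center_orthogonal dl.
have [+ _] := dual_center_orthogonal dr.
rewrite tp_flip tip_flip => zr hr.
have E f : on_circle (dcirc D f) (tp C d) ->
    complex.Re ((center (dcirc D f) - tp C d) *
     (center (circ C (tail d)) - tp C d)^*%C) = 0 ->
    exists a, NC f = stereo (tp C d) + a *: re_vec (weierstrass_form d).
  move=> zf /(dual_omega di zf)[t tE].
  have [k ->] := pole_offset (@hNC f) zf; exists (k * t); congr (_ + _).
  rewrite tE -!scalerA; congr (_ *: _); rewrite /weierstrass_form.
  by apply/rowP => j; rewrite !mxE; case: (_^-1 * _) => x y /=; ring.
have [a aE] := E _ zl hl; have [b bE] := E _ zr hr.
exists a, b; split=> //; have := pole_neq (@hNC l) (@hNC r) (dual_tangent D dl dr).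
by apply: contra_neq => ab; rewrite aE bE ab.
Qed.

Lemma dual_koebe_edge d : interior_dart d ->
  exists a b, [/\ a != b,
    ND (tip d) = stereo (tp C d) + a *: im_vec (weierstrass_form d) &
    ND (tail d) = stereo (tp C d) + b *: im_vec (weierstrass_form d)].
Proof.
move=> di; case: (di); case dl : (lface d) => [l|//] _ _.
have [zl hu hv] := dual_center_orthogonal dl.
have zu := on_circ_tail d; have zv := on_circ_tip d.
have [t tE] := dual_omega di zl hu.
have E u : on_circle (circ C u) (tp C d) ->
    complex.Re ((center (dcirc D l) - tp C d) *
     (center (circ C u) - tp C d)^*%C) = 0 ->
    exists a, ND u = stereo (tp C d) + a *: im_vec (weierstrass_form d).
  move=> zf hf.
  have [||s sE] := Re_mul_eq0_proportional (v := (center (circ C u) - tp C d)^*%C)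
     (w := 'i%C * (omega C d)^-1) (center_neq zl) _ hf.
  - by rewrite mulf_neq0 ?invr_eq0 ?omega_neq0// eq_complex /= oner_eq0 andbF.
  - have lE : center (dcirc D l) - tp C d = (t%:C * (omega C d)^-1)^*%C.
      by rewrite -tE conjcK.
    by rewrite lE; case: (omega C d)^-1 => x y /=; ring.
  (* The packing circles carry the direction [i / omega]; the sign comes from
     [Re (i w) = - Im w]. *)
  have [k ->] := pole_offset (@hND u) zf; exists (- (k * s)); congr (_ + _).
  rewrite sE -mulrN -!scalerA; congr (_ *: _); rewrite /weierstrass_form.
  by apply/rowP => j; rewrite !mxE; case: (_^-1 * _) => x y /=; ring.
have [a aE] := E _ zv hv; have [b bE] := E _ zu hu.
exists a, b; split=> //.
have := pole_neq (@hND (tail d)) (@hND (tip d)) (circ_tangent C d).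
by apply: contra_neq => ab; rewrite aE bE ab.
Qed.

End Packing.

(** * Real and imaginary parts of vectors, and cross product identities *)

Section ComplexVectors.
Variable R : realType.
Implicit Types (v w : 'rV[R[i]]_3).

Lemma re_vecZ (k : R) v : re_vec (k%:C *: v) = k *: re_vec v.
Proof. by apply/rowP => j; rewrite !mxE; case: (v 0 j) => x y /=; ring. Qed.

Lemma im_vecZ (k : R) v : im_vec (k%:C *: v) = k *: im_vec v.
Proof. by apply/rowP => j; rewrite !mxE; case: (v 0 j) => x y /=; ring. Qed.

Lemma re_vecD : {morph @re_vec R : v w / v + w}.
Proof.
by move=> v w; apply/rowP => j; rewrite !mxE; case: (v 0 j) (w 0 j) => ? ? [].
Qed.

Lemma im_vecD : {morph @im_vec R : v w / v + w}.
Proof.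
by move=> v w; apply/rowP => j; rewrite !mxE; case: (v 0 j) (w 0 j) => ? ? [].
Qed.

Lemma re_vecN : {morph @re_vec R : v / - v}.
Proof. by move=> v; apply/rowP => j; rewrite !mxE; case: (v 0 j). Qed.

Lemma im_vecN : {morph @im_vec R : v / - v}.
Proof. by move=> v; apply/rowP => j; rewrite !mxE; case: (v 0 j). Qed.

Lemma re_vec0 : re_vec 0 = 0 :> 'rV[R]_3.
Proof. by apply/rowP => j; rewrite !mxE. Qed.

Lemma im_vec0 : im_vec 0 = 0 :> 'rV[R]_3.
Proof. by apply/rowP => j; rewrite !mxE. Qed.

Lemma re_im_vec_inj v w : re_vec v = re_vec w -> im_vec v = im_vec w -> v = w.
Proof.
move=> /rowP E /rowP E'; apply/rowP => j; apply/eqP; rewrite eq_complex.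
by move: (E j) (E' j); rewrite !mxE => -> ->; rewrite !eqxx.
Qed.

Lemma cross_sum (I : Type) (s : seq I) (F : I -> 'rV[R]_3) (w : 'rV[R]_3) :
  cross (\sum_(i <- s) F i) w = \sum_(i <- s) cross (F i) w.
Proof.
have hD : {morph (@cross R)^~ w : u v / u + v}.
  move=> u v; elim/vec3P: u => a b c; elim/vec3P: v => a' b' c'.
  elim/vec3P: w => x y t; rewrite vec3D !cross_vec3 vec3D; congr vec3; ring.
have h0 : cross 0 w = 0.
  elim/vec3P: w {hD} => x y t; rewrite vec3_0 cross_vec3; congr vec3; ring.
exact: (big_morph _ hD h0).
Qed.

Lemma crossZl (k : R) (v w : 'rV[R]_3) : cross (k *: v) w = k *: cross v w.
Proof.
elim/vec3P: v => a b c; elim/vec3P: w => x y t.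
by rewrite vec3Z !cross_vec3 vec3Z; congr vec3; ring.
Qed.

Lemma cross_shift (v w : 'rV[R]_3) (k : R) : cross v (w + k *: v) = cross v w.
Proof.
elim/vec3P: v => a b c; elim/vec3P: w => x y t.
by rewrite vec3Z vec3D !cross_vec3; congr vec3; ring.
Qed.

(** [fr] and [fr + x *: k] are the mesh values right and left of an edge, [s + b *: k] and
    [s + a *: k] those of the normal. The first two terms on the right telescope around a vertex. *)
Lemma steiner_summand (fr k s : 'rV[R]_3) (x a b : R) :
  cross fr (s + a *: k) + cross (s + b *: k) (fr + x *: k) =
  cross (fr + x *: k) (s + a *: k) - cross fr (s + b *: k) -
    2 *: (x *: cross k s).
Proof.
elim/vec3P: fr => f1 f2 f3; elim/vec3P: k => k1 k2 k3; elim/vec3P: s => s1 s2 s3.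
rewrite (vec3Z a) (vec3Z b) !(vec3Z x k1) !(vec3D s1) !(vec3D f1).
rewrite !cross_vec3 !vec3Z !vec3N !vec3D.
by congr vec3; ring.
Qed.

Lemma sum_weierstrass (I : Type) (s : seq I) (c z : I -> R[i]) :
  \sum_(i <- s) c i *: weierstrass_vector (z i) =
  vec3 (\sum_(i <- s) c i - \sum_(i <- s) c i * z i ^+ 2)
       ('i%C * (\sum_(i <- s) c i + \sum_(i <- s) c i * z i ^+ 2))
       (2 * \sum_(i <- s) c i * z i).
Proof.
elim: s => [|i s IH].
  by rewrite !big_nil vec3_0 subr0 addr0 !mulr0.
by rewrite !big_cons IH vec3Z vec3D; congr vec3; ring.
Qed.

Lemma scale_inj (v : 'rV[R]_3) : v != 0 -> injective (fun k : R => k *: v).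
Proof.
move=> v0 x y /eqP; rewrite -subr_eq0 -scalerBl scaler_eq0 (negPf v0) orbF.
by rewrite subr_eq0 => /eqP.
Qed.

End ComplexVectors.

(** * Meshes with prescribed edge directions and their quadratic differentials *)

Section Main.
Variables (R : realType) (G : cell_decomposition) (C : circle_packing R G).
Variable D : dual_packing C.
Implicit Types (d : dart G) (lam : dart G -> R).
Local Notation kap := (weierstrass_form C).

Lemma weierstrass_form_flip d : interior_dart d -> kap (flip d) = - kap d.
Proof.
by move=> di; rewrite /weierstrass_form tp_flip omega_flip// invrN scaleNr.
Qed.

Lemma star_sum_seq (V : nmodType) (F : dart G -> V) u :
  \sum_(d \in star u) F d = \sum_(d <- fset_set (star u)) F d.
Proof. by rewrite fsbig_finite//; exact: finite_star. Qed.

(** The coordinates of the sum of [lam d * kap d] are invertible linear combinations of the three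
    sums defining a differential. *)
Lemma koebe_differentialP lam : koebe_quadratic_differential C lam <->
  (forall d, interior_dart d -> lam (flip d) = lam d) /\
  (forall u, interior_vertex u ->
    \sum_(d \in star u) lam d *: re_vec (kap d) = 0 /\
    \sum_(d \in star u) lam d *: im_vec (kap d) = 0).
Proof.
have E u : [/\ \sum_(d \in star u) (lam d)%:C / omega C d = 0,
        \sum_(d \in star u) (lam d)%:C / omega C d * tp C d = 0 &
        \sum_(d \in star u) (lam d)%:C / omega C d * tp C d ^+ 2 = 0] <->
    \sum_(d \in star u) (lam d)%:C *: kap d = 0.
  rewrite !star_sum_seq; under [X in _ <-> X = 0]eq_bigr do rewrite scalerA.
  rewrite sum_weierstrass vec3_0; split=> [[-> -> ->]|].
    by rewrite subr0 addr0 !mulr0.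
  have key (a b : R[i]) : a - b = 0 -> 'i%C * (a + b) = 0 -> a = 0 /\ b = 0.
    move=> /eqP; rewrite subr_eq0 => /eqP -> /eqP.
    rewrite -mulr2n mulf_eq0 mulrn_eq0 eq_complex /= oner_eq0 andbF /=.
    by move=> /eqP.
  move=> /vec3_inj[/key ab /ab[-> ->] /eqP].
  by rewrite mulf_eq0 pnatr_eq0 => /eqP.
have E' u : \sum_(d \in star u) (lam d)%:C *: kap d = 0 <->
    \sum_(d \in star u) lam d *: re_vec (kap d) = 0 /\
    \sum_(d \in star u) lam d *: im_vec (kap d) = 0.
  rewrite !star_sum_seq.
  under [X in _ <-> X = 0 /\ _]eq_bigr do rewrite -re_vecZ.
  under [X in _ <-> _ /\ X = 0]eq_bigr do rewrite -im_vecZ.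
  rewrite -(big_morph _ (@re_vecD R) (@re_vec0 R)).
  rewrite -(big_morph _ (@im_vecD R) (@im_vec0 R)).
  split=> [->|[hr hi]]; first by rewrite re_vec0 im_vec0.
  by apply: re_im_vec_inj; rewrite ?re_vec0 ?im_vec0.
by split=> -[ls h]; split=> // u /h; rewrite E E'.
Qed.

(** A common frame for both halves: [K] will be the real or the imaginary part of [kap]. *)
Definition edge_form (K : dart G -> 'rV[R]_3) lam (f : face G -> 'rV[R]_3) :=
  forall d l r, lface d = Some l -> lface (flip d) = Some r ->
    f l - f r = lam d *: K d.

Lemma realization_edge_form lam F : weierstrass_realization C lam F <->
  edge_form (fun d => re_vec (kap d)) lam (re_mesh F) /\
  edge_form (fun d => im_vec (kap d)) lam (im_mesh F).
Proof.
split=> [h|[hr hi] d l r dl dr].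
  split=> d l r dl dr; have := h d l r dl dr; rewrite -scalerA -/(kap d) => E.
    by rewrite -re_vecZ -E re_vecD re_vecN.
  by rewrite -im_vecZ -E im_vecD im_vecN.
rewrite -scalerA; apply: re_im_vec_inj.
  by rewrite re_vecD re_vecN re_vecZ; exact: hr.
by rewrite im_vecD im_vecN im_vecZ; exact: hi.
Qed.

Lemma realization_exists lam f g :
  edge_form (fun d => re_vec (kap d)) lam f ->
  edge_form (fun d => im_vec (kap d)) lam g ->
  exists F, [/\ weierstrass_realization C lam F,
    forall l, f l = re_mesh F l & forall l, g l = im_mesh F l].
Proof.
move=> hf hg; pose F l : 'rV[R[i]]_3 := \row_j (f l 0 j +i* g l 0 j).
have fE : f = re_mesh F by apply/funext => l; apply/rowP => j; rewrite !mxE.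
have gE : g = im_mesh F by apply/funext => l; apply/rowP => j; rewrite !mxE.
by exists F; split; rewrite -?fE -?gE//; apply/realization_edge_form; rewrite -fE -gE.
Qed.

Section EdgeForm.
Variable K : dart G -> 'rV[R]_3.
Hypothesis K_flip : forall d, interior_dart d -> K (flip d) = - K d.

Lemma edge_form_exact lam : simply_connected G ->
  (forall d, interior_dart d -> lam (flip d) = lam d) ->
  (forall u, interior_vertex u -> \sum_(d \in star u) lam d *: K d = 0) ->
  exists f, edge_form K lam f.
Proof.
move=> hG ls hs; apply: (dual_form_exact _ hs hG) => d di.
by rewrite ls// K_flip// scalerN.
Qed.

Lemma edge_form_star lam f u : edge_form K lam f -> interior_vertex u ->
  \sum_(d \in star u) lam d *: K d = 0.
Proof.
move=> hf hu; rewrite -[RHS](star_telescope (at_left f) u).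
apply: eq_fsbigr => d; rewrite inE => /(interior_vertexP hu).
rewrite /at_left lface_vprev => -[].
case dl : (lface d) => [l|//] _; case dr : (lface (flip d)) => [r|//] _ /=.
by rewrite (hf _ _ _ dl dr).
Qed.

Hypothesis K_neq0 : forall d, interior_dart d -> K d != 0.

Lemma edge_form_coeff f :
  (forall d l r, lface d = Some l -> lface (flip d) = Some r ->
    exists x : R, f l - f r = x *: K d) ->
  exists lam, edge_form K lam f.
Proof.
move=> h.
have h' d : exists x : R, forall l r, lface d = Some l ->
    lface (flip d) = Some r -> f l - f r = x *: K d.
  (* A dart lacking a face on either side imposes no condition; 0 is a default. *)
  case dl : (lface d) => [l|]; last by exists 0.
  case dr : (lface (flip d)) => [r|]; last by exists 0.
  by have [x xE] := h d l r dl dr; exists x => _ _ [<-] [<-].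
have [lam hlam] := choice h'.
by exists lam => d l r dl dr; apply: hlam.
Qed.

Lemma edge_form_flip lam f : edge_form K lam f ->
  forall d, interior_dart d -> lam (flip d) = lam d.
Proof.
move=> hf d di; have := K_neq0 di; case: (di).
case dl : (lface d) => [l|//] _; case dr : (lface (flip d)) => [r|//] _ Kd.
have E1 := hf _ _ _ dl dr; rewrite -(flipK d) in dl; have E2 := hf _ _ _ dr dl.
apply: (scale_inj Kd); apply: oppr_inj.
by rewrite -scalerN -K_flip// -E2 -E1 opprB.
Qed.

Lemma edge_form_unique lam lam' f : edge_form K lam f -> edge_form K lam' f ->
  forall d, interior_dart d -> lam' d = lam d.
Proof.
move=> hf hf' d di; have := K_neq0 di; case: di.
case dl : (lface d) => [l|//] _; case dr : (lface (flip d)) => [r|//] _ Kd.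
by apply: (scale_inj Kd); rewrite -(hf _ _ _ dl dr) -(hf' _ _ _ dl dr).
Qed.

End EdgeForm.

Lemma re_form_flip d : interior_dart d ->
  re_vec (kap (flip d)) = - re_vec (kap d).
Proof. by move=> di; rewrite weierstrass_form_flip// re_vecN. Qed.

Lemma im_form_flip d : interior_dart d ->
  im_vec (kap (flip d)) = - im_vec (kap d).
Proof. by move=> di; rewrite weierstrass_form_flip// im_vecN. Qed.

Lemma re_form_neq0 d : interior_dart d -> re_vec (kap d) != 0.
Proof. by move=> di; rewrite re_weierstrass_neq0// invr_eq0 (omega_neq0 D). Qed.

Lemma im_form_neq0 d : interior_dart d -> im_vec (kap d) != 0.
Proof. by move=> di; rewrite im_weierstrass_neq0// invr_eq0 (omega_neq0 D). Qed.

Variables (NC : face G -> 'rV[R]_3) (ND : vertex G -> 'rV[R]_3).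
Hypothesis hNC : koebe_surface D NC.
Hypothesis hND : dual_koebe_surface C ND.

Lemma parallel_mesh_edge_form f : parallel_mesh NC f <->
  exists lam, edge_form (fun d => re_vec (kap d)) lam f.
Proof.
split=> [h|[lam h] d l r dl dr].
  apply: edge_form_coeff => d l r dl dr; have [x ->] := h d l r dl dr.
  have [a [b [_ -> ->]]] := koebe_edge hNC dl dr; exists (x * (a - b)).
  by rewrite opprD addrACA subrr add0r -scalerBl scalerA.
have [a [b [ab -> ->]]] := koebe_edge hNC dl dr; exists (lam d / (a - b)).
rewrite (h d l r dl dr) opprD addrACA subrr add0r -scalerBl scalerA.
by rewrite divfK// subr_eq0.
Qed.

Lemma reciprocal_mesh_edge_form g : reciprocal_parallel_mesh ND g <->
  exists lam, edge_form (fun d => im_vec (kap d)) lam g.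
Proof.
split=> [h|[lam h] d l r dl dr].
  apply: edge_form_coeff => d l r dl dr; have [x ->] := h d l r dl dr.
  have di : interior_dart d by rewrite /interior_dart dl dr.
  have [a [b [_ -> ->]]] := dual_koebe_edge D hND di; exists (x * (a - b)).
  by rewrite opprD addrACA subrr add0r -scalerBl scalerA.
have di : interior_dart d by rewrite /interior_dart dl dr.
have [a [b [ab -> ->]]] := dual_koebe_edge D hND di; exists (lam d / (a - b)).
rewrite (h d l r dl dr) opprD addrACA subrr add0r -scalerBl scalerA.
by rewrite divfK// subr_eq0.
Qed.

(** Up to a telescoping term, Steiner's summand of an edge is
    [- 2 (f l - f r) x stereo (tp d)], and [x stereo (tp d)] is the quarter turn
    that exchanges the real and the imaginary part of the form. *)
Lemma mean_curvature_star lam f u :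
  edge_form (fun d => re_vec (kap d)) lam f -> interior_vertex u ->
  \sum_(d \in star u) (cross (at_right f d) (at_left NC d) +
                       cross (at_right NC d) (at_left f d)) =
  - (2 *: \sum_(d \in star u) lam d *: im_vec (kap d)).
Proof.
move=> hf hu; pose Q d := cross (at_left f d) (at_left NC d).
transitivity (\sum_(d \in star u)
    ((Q d - Q (vprev d)) - 2 *: (lam d *: im_vec (kap d)))); last first.
  rewrite star_sumB star_telescope sub0r; congr (- _).
  by rewrite !star_sum_seq scaler_sumr.
apply: eq_fsbigr => d; rewrite inE => /(interior_vertexP hu).
rewrite /Q /at_right /at_left lface_vprev => -[].
case dl : (lface d) => [l|//] _; case dr : (lface (flip d)) => [r|//] _ /=.
have [a [b [_ -> ->]]] := koebe_edge hNC dl dr.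
have := hf _ _ _ dl dr => /eqP; rewrite subr_eq addrC => /eqP ->.
by rewrite steiner_summand cross_re_stereo.
Qed.

(** The real part of the form closes up because [f] exists, the imaginary part because the mean
    curvature vanishes. *)
Lemma koebe_minimal_edge_form f : koebe_minimal_surface NC f <->
  exists lam, koebe_quadratic_differential C lam /\
    edge_form (fun d => re_vec (kap d)) lam f.
Proof.
split=> [[/parallel_mesh_edge_form[lam hf] mc]|[lam [/koebe_differentialP[_ h] hf]]].
  exists lam; split=> //; apply/koebe_differentialP; split.
    exact: (edge_form_flip re_form_flip re_form_neq0 hf).
  move=> u hu; split; first exact: (edge_form_star hf).
  have := mc u hu; rewrite (mean_curvature_star hf hu) => /eqP.
  by rewrite oppr_eq0 scaler_eq0 pnatr_eq0 => /eqP.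
split; first by apply/parallel_mesh_edge_form; exists lam.
by move=> u hu; rewrite (mean_curvature_star hf hu) (h u hu).2 scaler0 oppr0.
Qed.

(** At a vertex [u], the cross product with [stereo (tp d)] may be replaced by
    that with [ND u], which is the same for all edges. *)
Lemma reciprocal_differential lam g :
  edge_form (fun d => im_vec (kap d)) lam g -> koebe_quadratic_differential C lam.
Proof.
move=> hg; apply/koebe_differentialP; split.
  exact: (edge_form_flip im_form_flip im_form_neq0 hg).
move=> u hu; have h0 := edge_form_star hg hu; split=> //.
transitivity (- cross (\sum_(d \in star u) lam d *: im_vec (kap d)) (ND u)).
  rewrite [X in cross X]star_sum_seq cross_sum -sumrN -star_sum_seq.
  apply: eq_fsbigr => d; rewrite inE => du; have di := interior_vertexP hu du.
  have [a [b [_ _ E]]] := dual_koebe_edge D hND di; rewrite -du E.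
  by rewrite crossZl cross_shift cross_im_stereo scalerN opprK.
rewrite h0 (vec3_eta (ND u)) vec3_0 cross_vec3 vec3N.
by rewrite !mul0r subrr oppr0.
Qed.

End Main.

Theorem theorem5p2 (R : realType) (G : cell_decomposition)
    (hG : simply_connected G)
    (C : circle_packing R G) (D : dual_packing C)
    (NC : face G -> 'rV[R]_3) (hNC : koebe_surface D NC)
    (ND : vertex G -> 'rV[R]_3) (hND : dual_koebe_surface C ND) :
  (forall lam : dart G -> R, koebe_quadratic_differential C lam ->
     exists F : face G -> 'rV[R[i]]_3,
       [/\ weierstrass_realization C lam F,
           koebe_minimal_surface NC (re_mesh F),
           reciprocal_parallel_mesh ND (im_mesh F) &
           same_edge_lengths (re_mesh F) (im_mesh F)]) /\
  (forall f : face G -> 'rV[R]_3, koebe_minimal_surface NC f ->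
     exists lam : dart G -> R,
       [/\ koebe_quadratic_differential C lam,
           exists F, weierstrass_realization C lam F /\
                     (forall l, f l = re_mesh F l) &
           forall lam' : dart G -> R, koebe_quadratic_differential C lam' ->
             (exists F, weierstrass_realization C lam' F /\
                        (forall l, f l = re_mesh F l)) ->
             forall d, interior_dart d -> lam' d = lam d]) /\
  (forall g : face G -> 'rV[R]_3, reciprocal_parallel_mesh ND g ->
     exists lam : dart G -> R,
       [/\ koebe_quadratic_differential C lam,
           exists F, weierstrass_realization C lam F /\
                     (forall l, g l = im_mesh F l) &
           forall lam' : dart G -> R, koebe_quadratic_differential C lam' ->
             (exists F, weierstrass_realization C lam' F /\
                        (forall l, g l = im_mesh F l)) ->
             forall d, interior_dart d -> lam' d = lam d]).
Proof.
have K_re := re_form_flip D; have K_im := im_form_flip D.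
split; [|split].
- move=> lam hl; have /koebe_differentialP[ls h] := hl.
  have [f hf] := edge_form_exact K_re hG ls (fun u hu => (h u hu).1).
  have [g hg] := edge_form_exact K_im hG ls (fun u hu => (h u hu).2).
  have [F [hF _ _]] := realization_exists hf hg.
  have /realization_edge_form[hr hi] := hF.
  exists F; split=> //.
  + by apply/(koebe_minimal_edge_form hNC); exists lam.
  + by apply/(reciprocal_mesh_edge_form D hND); exists lam.
  + move=> d l r dl dr; rewrite (hr _ _ _ dl dr) (hi _ _ _ dl dr).
    by rewrite -re_vecZ -im_vecZ scalerA /euclidean_norm dot_re_im_weierstrass.
- move=> f /(koebe_minimal_edge_form hNC)[lam [hl hf]].
  have /koebe_differentialP[ls h] := hl.
  (* The conjugate mesh, integrated from the same [lam], supplies the imaginary part of [F]. *)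
  have [g hg] := edge_form_exact K_im hG ls (fun u hu => (h u hu).2).
  have [F [hF fE _]] := realization_exists hf hg.
  exists lam; split=> //; first by exists F.
  move=> lam' _ [F' [/realization_edge_form[hr _] fE']].
  by apply: (edge_form_unique (re_form_neq0 D) hf); rewrite (funext fE').
- move=> g /(reciprocal_mesh_edge_form D hND)[lam hg].
  have hl := reciprocal_differential D hND hg.
  have /koebe_differentialP[ls h] := hl.
  have [f hf] := edge_form_exact K_re hG ls (fun u hu => (h u hu).1).
  have [F [hF _ gE]] := realization_exists hf hg.
  exists lam; split=> //; first by exists F.
  move=> lam' _ [F' [/realization_edge_form[_ hi] gE']].
  by apply: (edge_form_unique (im_form_neq0 D) hg); rewrite (funext gE').
Qed.
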